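(* Let the collision term be $\mathcal C(f)=-\phi_0f+\phi_0\frac12\int_{-1}^1f\,d\mu+3\mu\phi_1\frac12\int_{-1}^1f\mu\,d\mu$, with $\tilde\chi\ne0$, $\tilde\chi+\phi_0\ne0$ and $\tilde\chi+\phi_0-\phi_1\neq0$. Consider a decomposition $f=f^t+f^s$, inducing $\beta=\beta^t+\beta^s$ with $\beta^t=\frac12\int_{-1}^1f^t\,d\mu$ and $\beta^s=\frac12\int_{-1}^1f^s\,d\mu$. Assume Enskog's postulate, the weakened Chapman--Enskog hypothesis $$\frac12\int_{-1}^1f_0\,d\mu=\beta^t,\qquad\sum_{i=1}^\infty\Big(\frac12\int_{-1}^1\varepsilon^if_i\,d\mu\Big)=\beta^s,$$ and the asymptotic properties $\frac{\partial\beta^s}{\partial\beta}=\mathcal O(\varepsilon^2)$ and $\frac{\partial\beta_1}{\partial\beta}=\mathcal O(\varepsilon^2)$, for the Chapman--Enskog expansion $f=\sum_{i\ge0}\varepsilon^if_i$. Then the diffusion-reaction-type equation $$\frac{d\beta^t}{c\,dt}+\frac13\frac{d\ln\rho}{c\,dt}\,\omega\frac{\partial\beta^t}{\partial\omega}-\frac1{r^2}\frac{\partial}{\partial r}\Big(r^2\frac\lambda3\frac{\partial\beta^t}{\partial r}\Big)=j-\tilde\chi(\beta^t+\beta^s)$$ is an approximation of the angular mean of Boltzmann's equation $\mathcal D(f)=\varepsilon^{-1}\big(\bar j+\bar{\mathcal J}(f)\big)$ of order $\mathcal O(\varepsilon^2)$ up to $\mathcal D^+\big(\mathcal D^+(\cdot)\big)$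 terms. In the same sense, $$\Sigma_{\rm diff}:=-\frac1{r^2}\frac{\partial}{\partial r}\Big(r^2\frac\lambda3\frac{\partial\beta^t}{\partial r}\Big)+\tilde\chi\beta^s$$ is an approximation of the (angular mean of the) diffusion source $\Sigma$ in the trapped particle equation $$\frac{d\beta^t}{c\,dt}+\frac13\frac{d\ln\rho}{c\,dt}\,\omega\frac{\partial\beta^t}{\partial\omega}=j-\tilde\chi\beta^t-\Sigma .$$
   Context: Variables: time $t$, radius $r>0$, cosine of the propagation angle $\mu\in[-1,1]$, energy $\omega>0$; $f=f(t,r,\mu,\omega)$. The constant $c>0$ is the speed of light; $\rho=\rho(t,r)>0$ and $v=v(t,r)$ are given functions (density and radial velocity of the background matter), and $\frac{d}{dt}:=\frac{\partial}{\partial t}+v\frac{\partial}{\partial r}$. The linear operator $\mathcal D=\mathcal D^++\mathcal D^-$ is given by $$\mathcal D^+(f)=\frac{df}{c\,dt}+\mu\Big(\frac{d\ln\rho}{c\,dt}+\frac{3v}{cr}\Big)(1-\mu^2)\frac{\partial f}{\partial\mu}+\Big[\mu^2\Big(\frac{d\ln\rho}{c\,dt}+\frac{3v}{cr}\Big)-\frac v{cr}\Big]\omega\frac{\partial f}{\partial\omega},$$ $$\mathcal D^-(f)=\mu\frac{\partial f}{\partial r}+\frac1r(1-\mu^2)\frac{\partial f}{\partial\mu}.$$ Write $F_\mu$ and $F_\omega$ for the total coefficients of $\frac{\partial f}{\partial\mu}$ and $\frac{\partial f}{\partial\omega}$ in $\mathcal D$. The functions $j\ge0$ (emissivity), $\chi\geq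 0$ (absorptivity), $\tilde\chi=j+\chi$, $\phi_0,\phi_1$ depend on $(t,r,\omega)$ but not on $\mu$. Put $\mathcal J(f)=-\tilde\chi f+\mathcal C(f)$ and $\lambda=\frac1{\tilde\chi+\phi_0-\phi_1}$. Here $\varepsilon>0$ is a small parameter, $\bar j=\varepsilon j$, $\bar{\tilde\chi}=\varepsilon\tilde\chi$, $\bar\phi_0=\varepsilon\phi_0$, $\bar\phi_1=\varepsilon\phi_1$, $\bar{\mathcal J}=\varepsilon\mathcal J$, and the barred quantities are independent of $\varepsilon$ (so $j,\tilde\chi$ are of order $\varepsilon^{-1}$ and $\lambda$ is of order $\varepsilon$). Chapman--Enskog expansion: $f=\sum_{i\ge0}\varepsilon^i f_i$, $\beta=\frac12\int_{-1}^1f\,d\mu=\sum_{i\ge0}\varepsilon^i\beta_i$, $\beta_i=\frac12\int_{-1}^1 f_i\,d\mu$. Enskog's postulate: $f=f\big(r,\mu,\omega\,|\,\beta,\frac{\partial\beta}{\partial r},\frac{\partial^2\beta}{\partial r^2},\dots\big)$, and likewise all $f_i$, depend on time only via $\beta$ and its spatial derivatives; these are treated as independent variables, and the $\beta_i$ do not depend on the spatial derivatives of $\beta$. With $\frac{\partial_i}{\partial t}:=\sum_{k=0}^\infty\frac{\partial^k}{\partial r^k}\frac{\partial\beta_i}{\partial t}\cdot\frac{\partial}{\partial\frac{\partial^k\beta}{\partial r^k}}$ one has formally $\mathcal D(f)=\sum_{i\ge0}\varepsilon^i\mathcal D(f)^{(i)}$, $$\mathcal D(f)^{(i)}=\sum_{l=0}^i\frac{\partial_{i-l}f_l}{c\,\partial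 t}+v\frac{\partial f_i}{c\,\partial r}+\mu\frac{\partial f_i}{\partial r}+F_\mu\frac{\partial f_i}{\partial\mu}+F_\omega\frac{\partial f_i}{\partial\omega},$$ and the $f_i$ solve the hierarchy $0=j+\mathcal J(f_0)$, $\mathcal D(f)^{(i-1)}=\bar{\mathcal J}(f_i)$, $i=1,2,\dots$. Meaning of the conclusion: the angular mean of Boltzmann's equation is $\frac12\int_{-1}^1\mathcal D(f)\,d\mu=j-\tilde\chi\beta$. The conclusion states that its left-hand side equals the left-hand side of the displayed diffusion-reaction-type equation, plus $N$, plus $\mathcal O(\varepsilon^2)$, where $N$ is the sum of the neglected $\mathcal D^+(\mathcal D^+(\cdot))$ terms, $$N=\frac12\int_{-1}^1\mathcal D^+\Big(\frac{-1}{\tilde\chi+\phi_0}\Big[\mathcal D^+(f_0)+\frac{\phi_0}{\tilde\chi}\frac12\int_{-1}^1\mathcal D^+(f_0)\,d\mu+3\mu\phi_1\lambda\frac12\int_{-1}^1\mathcal D^+(f_0)\mu\,d\mu\Big]\Big)d\mu ;$$ and that the $\Sigma$ determined by the trapped particle equation equals $\Sigma_{\rm diff}$ in the same sense. The component $f^t$ is not assumed to be isotropic, so the trapped particle equation is written for its angular mean $\beta^t$. All series are formal; series, integrals and partial derivatives are assumed to be interchangeable; $\mathcal O(\varepsilon^k)$ denotes, in the formal sense, the neglected part starting with order $\varepsilon^k$ of a formal series in $\varepsilon$. *)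

(* Defs.v *)
From Stdlib Require Import Reals ZArith List.
From Coquelicot Require Import Coquelicot.

Open Scope R_scope.

(** * Fields on phase space *)

(* Functions of (t, r, mu, omega).  Functions that do not depend on mu (or on
   mu and omega) are embedded as fields that ignore these arguments. *)
Definition field : Type := R -> R -> R -> R -> R.

Definition iso (g : R -> R -> R -> R) : field := fun t r _ om => g t r om.
Definition matter (g : R -> R -> R) : field := fun t r _ _ => g t r.

Definition dom (r mu om : R) : Prop := 0 < r /\ -1 <= mu <= 1 /\ 0 < om.

Definition d_t (u : field) : field :=
  fun t r mu om => Derive (fun s => u s r mu om) t.
Definition d_r (u : field) : field :=
  fun t r mu om => Derive (fun s => u t s mu om) r.
Definition d_mu (u : field) : field :=
  fun t r mu om => Derive (fun s => u t r s om) mu.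
Definition d_om (u : field) : field :=
  fun t r mu om => Derive (fun s => u t r mu s) om.

(* One half of the integral over mu in [-1, 1]. *)
Definition mean (u : field) : field :=
  fun t r _ om => / 2 * RInt (fun mu => u t r mu om) (-1) 1.

Inductive axis := axis_t | axis_r | axis_mu | axis_om.

Definition partial (a : axis) : field -> field :=
  match a with
  | axis_t => d_t | axis_r => d_r | axis_mu => d_mu | axis_om => d_om
  end.

Definition ex_partial (a : axis) (u : field) (t r mu om : R) : Prop :=
  match a with
  | axis_t => ex_derive (fun s => u s r mu om) t
  | axis_r => ex_derive (fun s => u t s mu om) r
  | axis_mu => ex_derive (fun s => u t r s om) mu
  | axis_om => ex_derive (fun s => u t r mu s) om
  end.

(* C^infinity: all iterated partial derivatives exist and are jointly
   continuous.  At mu = -1 and mu = 1 this is smoothness up to the boundary,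
   in the form of a smooth extension to a neighbourhood; values of a field for
   mu outside [-1, 1] play no other role, because d_mu always occurs with the
   factor 1 - mu^2. *)
Definition smooth (u : field) : Prop :=
  forall (l : list axis) (t r mu om : R), dom r mu om ->
    let w := fold_right partial u l in
    continuous (fun p : R * (R * (R * R)) =>
                  w (fst p) (fst (snd p)) (fst (snd (snd p)))
                    (snd (snd (snd p)))) (t, (r, (mu, om))) /\
    forall a, ex_partial a w t r mu om.

(** * Boltzmann's equation *)

(* The emissivity is j = jbar / eps, and likewise for chi, phi0 and phi1; only
   the eps-independent barred functions are data. *)
Record medium := Medium {
  light : R;
  rho : R -> R -> R;
  vel : R -> R -> R;
  jbar : R -> R -> R -> R;
  chibar : R -> R -> R -> R;
  phi0bar : R -> R -> R -> R;
  phi1bar : R -> R -> R -> R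
}.

Definition chitbar (M : medium) : R -> R -> R -> R :=
  fun t r om => jbar M t r om + chibar M t r om.

(* lambda = eps * lambar *)
Definition lambar (M : medium) : R -> R -> R -> R :=
  fun t r om => / (chitbar M t r om + phi0bar M t r om - phi1bar M t r om).

Definition medium_regular (M : medium) : Prop :=
  0 < light M /\
  (forall t r, 0 < r -> 0 < rho M t r) /\
  smooth (matter (rho M)) /\ smooth (matter (vel M)) /\
  smooth (iso (jbar M)) /\ smooth (iso (chibar M)) /\
  smooth (iso (phi0bar M)) /\ smooth (iso (phi1bar M)) /\
  (forall t r om, 0 < r -> 0 < om -> 0 <= jbar M t r om) /\
  (forall t r om, 0 < r -> 0 < om -> 0 <= chibar M t r om).

(* d/dt = d_t + v d_r *)
Definition Ddt (M : medium) (u : field) : field :=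
  fun t r mu om => d_t u t r mu om + vel M t r * d_r u t r mu om.

(* (d ln rho) / (c dt) *)
Definition dlnrho (M : medium) : field :=
  fun t r mu om => Ddt M (matter (fun t r => ln (rho M t r))) t r mu om / light M.

Definition Dplus (M : medium) (u : field) : field := fun t r mu om =>
  Ddt M u t r mu om / light M
  + mu * (dlnrho M t r mu om + 3 * vel M t r / (light M * r)) * (1 - mu ^ 2)
    * d_mu u t r mu om
  + (mu ^ 2 * (dlnrho M t r mu om + 3 * vel M t r / (light M * r))
     - vel M t r / (light M * r)) * om * d_om u t r mu om.

Definition Dminus (M : medium) (u : field) : field := fun t r mu om =>
  mu * d_r u t r mu om + 1 / r * (1 - mu ^ 2) * d_mu u t r mu om.

Definition Dop (M : medium) (u : field) : field := fun t r mu om =>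
  Dplus M u t r mu om + Dminus M u t r mu om.

Definition F_mu (M : medium) : field := fun t r mu om =>
  mu * (dlnrho M t r mu om + 3 * vel M t r / (light M * r)) * (1 - mu ^ 2)
  + 1 / r * (1 - mu ^ 2).

Definition F_om (M : medium) : field := fun t r mu om =>
  (mu ^ 2 * (dlnrho M t r mu om + 3 * vel M t r / (light M * r))
   - vel M t r / (light M * r)) * om.

(* eps * C *)
Definition Cbar (M : medium) (u : field) : field := fun t r mu om =>
  - phi0bar M t r om * u t r mu om
  + phi0bar M t r om * mean u t r mu om
  + 3 * mu * phi1bar M t r om
    * mean (fun t r mu om => u t r mu om * mu) t r mu om.

(* eps * J *)
Definition Jbar (M : medium) (u : field) : field := fun t r mu om =>
  - chitbar M t r om * u t r mu om + Cbar M u t r mu om.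

(** * Formal power series in eps *)

(* A formal power series is its sequence of coefficients.  The coefficients
   f_i of the Chapman-Enskog expansion depend on eps through beta, so each f_i
   is itself a formal power series, and f_i has type [nat -> field].
   [eps_sum i0 a] is the series sum_(i >= i0) eps^i a_i. *)
Definition eps_sum (i0 : nat) (a : nat -> nat -> R) : nat -> R :=
  fun n => sum_n_m (fun i => a i (n - i)%nat) i0 n.

Definition eps_sum_field (i0 : nat) (a : nat -> nat -> field) : nat -> field :=
  fun n t r mu om => eps_sum i0 (fun i p => a i p t r mu om) n.

Definition is_O_eps (k : nat) (a : nat -> R) : Prop :=
  forall n, (n < k)%nat -> a n = 0.

(** * Dependence on beta and its spatial derivatives *)

(* [y k p] is the coefficient of eps^p in the independent variable that stands
   for the k-th r-derivative of beta. *)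
Definition jet : Type := nat -> nat -> R.

Definition jet_at (beta : nat -> R -> R -> R -> R) (t r om : R) : jet :=
  fun k p => Derive_n (fun s => beta p t s om) k r.

Definition jet_shift (y : jet) (k : nat) (h : R) : jet :=
  fun k' p => if (Nat.eqb k' k && Nat.eqb p 0)%bool then y k' p + h else y k' p.

(* The partial derivative of phi with respect to the k-th jet variable. *)
Definition jet_partial (k : nat) (phi : jet -> nat -> R) (y : jet) : nat -> R :=
  fun n => Derive (fun h => phi (jet_shift y k h) n) 0.

(* Hadamard differentiability over the ring R[[eps]]: along every curve through
   y that is differentiable coefficientwise, phi has the derivative
   sum_k (d y_k) * (d phi / d y_k), where * is the product of formal power
   series.  Finite-order smooth functions of the jet variables, extended to
   formal series by Taylor expansion, have this property. *)
Definition jet_differentiable (phi : jet -> nat -> R) (y : jet) : Prop :=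
  forall (gam : R -> jet) (dgam : jet) (s0 : R),
    gam s0 = y ->
    (forall k p, is_derive (fun s => gam s k p) s0 (dgam k p)) ->
    forall n,
      ex_series (fun k => PS_mult (dgam k) (jet_partial k phi y) n) /\
      is_derive (fun s => phi (gam s) n) s0
        (Series (fun k => PS_mult (dgam k) (jet_partial k phi y) n)).

(* Functions F(r, mu, omega | beta, d_r beta, ...) without explicit time. *)
Definition functional : Type := R -> R -> R -> jet -> nat -> R.

Definition mean_functional (F : functional) (r om : R) : jet -> nat -> R :=
  fun y n => / 2 * RInt (fun mu => F r mu om y n) (-1) 1.

(* beta^s = sum_(i >= 1) eps^i beta_i as a function of the jet variables. *)
Definition betas_functional (F : nat -> functional) (r om : R) :
    jet -> nat -> R :=
  fun y => eps_sum 1 (fun i => mean_functional (F i) r om y).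

Definition enskog_postulate (F : nat -> functional)
    (beta : nat -> R -> R -> R -> R) (f : nat -> nat -> field) : Prop :=
  (forall i n t r mu om, dom r mu om ->
     f i n t r mu om = F i r mu om (jet_at beta t r om) n) /\
  (forall i t r mu om, dom r mu om ->
     jet_differentiable (F i r mu om) (jet_at beta t r om)) /\
  (forall i t r om, 0 < r -> 0 < om ->
     jet_differentiable (mean_functional (F i) r om) (jet_at beta t r om)) /\
  (forall i r om (y y' : jet), 0 < r -> 0 < om -> y 0%nat = y' 0%nat ->
     mean_functional (F i) r om y = mean_functional (F i) r om y').

(** * Chapman-Enskog expansion *)

(* (d_i f_l) / (d t), the contribution of d_t beta_i to d_t f_l. *)
Definition d_t_part (F : nat -> functional) (beta : nat -> R -> R -> R -> R)
    (f : nat -> nat -> field) (i l : nat) : nat -> field :=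
  fun n t r mu om =>
    Series (fun k =>
      PS_mult (fun p => Derive_n (fun s => d_t (mean (f i p)) t s mu om) k r)
              (jet_partial k (F l r mu om) (jet_at beta t r om)) n).

(* D(f)^(i) *)
Definition D_order (M : medium) (F : nat -> functional)
    (beta : nat -> R -> R -> R -> R) (f : nat -> nat -> field) (i : nat) :
    nat -> field :=
  fun n t r mu om =>
    sum_n (fun l => d_t_part F beta f (i - l) l n t r mu om / light M) i
    + vel M t r * d_r (f i n) t r mu om / light M
    + mu * d_r (f i n) t r mu om
    + F_mu M t r mu om * d_mu (f i n) t r mu om
    + F_om M t r mu om * d_om (f i n) t r mu om.

(* 0 = j + J(f_0) is written after multiplication by eps. *)
Definition hierarchy (M : medium) (F : nat -> functional)
    (beta : nat -> R -> R -> R -> R) (f : nat -> nat -> field) : Prop :=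
  (forall n t r mu om, dom r mu om ->
     0 = (if Nat.eqb n 0 then jbar M t r om else 0)
         + Jbar M (f 0%nat n) t r mu om) /\
  (forall i n t r mu om, dom r mu om ->
     D_order M F beta f i n t r mu om = Jbar M (f (S i) n) t r mu om).

(** * Formal Laurent series in eps *)

Definition laurent : Type := Z -> field.

Definition embed (a : nat -> field) : laurent := fun n t r mu om =>
  if Z.ltb n 0 then 0 else a (Z.to_nat n) t r mu om.

(* Multiplication by eps^k. *)
Definition eps_mul (k : Z) (a : laurent) : laurent := fun n => a (n - k)%Z.

Definition laurent_O (k : Z) (a : laurent) : Prop :=
  forall n t r mu om, (n < k)%Z -> dom r mu om -> a n t r mu om = 0.

(* j = eps^-1 jbar *)
Definition emissivity (M : medium) : laurent :=
  eps_mul (-1) (embed (fun n t r mu om =>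
                         if Nat.eqb n 0 then jbar M t r om else 0)).

(* chitilde b = eps^-1 chitbar b *)
Definition absorption (M : medium) (b : nat -> field) : laurent :=
  eps_mul (-1) (embed (fun n t r mu om => chitbar M t r om * b n t r mu om)).

(* d b / (c dt) + 1/3 (d ln rho / (c dt)) omega (d b / d omega) *)
Definition transport (M : medium) (b : nat -> field) : laurent :=
  embed (fun n t r mu om =>
    Ddt M (b n) t r mu om / light M
    + 1 / 3 * dlnrho M t r mu om * om * d_om (b n) t r mu om).

(* - r^-2 d_r (r^2 (lambda / 3) d_r b), with lambda = eps lambar *)
Definition diffusion (M : medium) (b : nat -> field) : laurent :=
  eps_mul 1 (embed (fun n t r mu om =>
    - (1 / r ^ 2)
    * d_r (fun t r mu om =>
             r ^ 2 * (lambar M t r om / 3) * d_r (b n) t r mu om) t r mu om)).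

(* N.  Here -1 / (chitilde + phi0) = - eps / (chitbar + phi0bar), while
   phi0 / chitilde = phi0bar / chitbar and phi1 lambda = phi1bar lambar. *)
Definition neglected (M : medium) (f0 : nat -> field) : laurent :=
  eps_mul 1 (embed (fun n =>
    let g := Dplus M (f0 n) in
    mean (Dplus M (fun t r mu om =>
      - 1 / (chitbar M t r om + phi0bar M t r om)
      * (g t r mu om
         + phi0bar M t r om / chitbar M t r om * mean g t r mu om
         + 3 * mu * phi1bar M t r om * lambar M t r om
           * mean (fun t r mu om => g t r mu om * mu) t r mu om))))).

(* The left-hand side of the angular mean of Boltzmann's equation. *)
Definition mean_boltzmann (M : medium) (f : nat -> field) : laurent :=
  embed (fun n => mean (Dop M (f n))).

(* d b / (c dt) + 1/3 (d ln rho / (c dt)) omega (d b / d omega)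
   = j - chitilde b - Sigma *)
Definition trapped_particle_equation (M : medium) (b : nat -> field)
    (Sigma : laurent) : Prop :=
  forall n t r mu om, dom r mu om ->
    transport M b n t r mu om
    = emissivity M n t r mu om - absorption M b n t r mu om
      - Sigma n t r mu om.

(* Main.v *)
Require Import Defs.
From Stdlib Require Import Reals ZArith List.
From Coquelicot Require Import Coquelicot.
From Stdlib Require Import Lra Lia FunctionalExtensionality.
Open Scope R_scope.

(** The equation [0 = j + J(f_0)] forces [f_0 = j / chitilde], which is isotropic
    and free of eps-corrections, and [D(f_0) = Jbar(f_1)] then makes [f_1] quadratic
    in mu: its even part is the [D^+]-response whose [D^+]-mean is [N], and its odd
    part is the flux [- lambda mu d_r beta^t], whose [D^-]-mean is the diffusion term.
    The cross terms are odd in mu and average out, so the approximation is exact at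
    the orders eps^0 and eps^1.  The angular mean of Boltzmann's equation
    holds at every order because the chain rule along the jet of beta turns
    [sum_i eps^i D(f)^(i)] back into [D(f)], while [mean (Jbar u) = - chitbar mean u]. *)

(* Coquelicot's lemmas leave equations in the carrier of a structure over [R],
   which [ring] and [field] do not recognise. *)
Ltac eq_in_R := match goal with |- ?a = ?b => change (@eq R a b) end.

(** Apart from multiplication by -(chitbar + phi0bar), [Jbar] sees the mu-dependence of its argument
    only through the moments of order 0 and 1. Constants and mu are eigenvectors, with eigenvalues
    -chitbar and -1/lambar, so each equation of the hierarchy is solved in closed form, and the
    inverse is the very expression that [neglected] places between its two [Dplus]. Two obstacles
    shape the rest. Each f_i is itself a series in eps, so order n of f mixes all f_i with i <= n;
    since f_0 stops at its leading coefficient, orders 0 and 1 of f reduce to the leading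
    coefficients of f_0 and f_1. Moreover, smoothness is known for the f_i, not for the coefficients
    of their powers of mu, and the hierarchy says nothing beyond mu = 1 and -1: the coefficients are
    recovered by interpolation in mu, and the endpoints are absorbed by the factor 1 - mu^2. *)

Lemma locally_pos (x : R) : 0 < x -> locally x (fun s => 0 < s).
Proof.
  intros Hx; exists (mkposreal x Hx); intros s Hs.
  apply Rabs_def2 in Hs; unfold minus, plus, opp in Hs; simpl in Hs; lra.
Qed.

Lemma locally_open_interval (x : R) :
  -1 < x < 1 -> locally x (fun s => -1 <= s <= 1).
Proof.
  intros Hx.
  assert (He : 0 < Rmin (x + 1) (1 - x)) by (apply Rmin_glb_lt; lra).
  exists (mkposreal _ He); intros s Hs; simpl in Hs.
  apply Rabs_def2 in Hs; unfold minus, plus, opp in Hs; simpl in Hs.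
  pose proof (Rmin_l (x + 1) (1 - x)); pose proof (Rmin_r (x + 1) (1 - x)); lra.
Qed.

Lemma continuous_pair {U V W : UniformSpace} (g : U -> V) (h : U -> W) (x : U) :
  continuous g x -> continuous h x -> continuous (fun u => (g u, h u)) x.
Proof.
  intros Hg Hh P [e He].
  assert (Ig : locally x (fun u => ball (g x) e (g u))) by (apply Hg; exists e; auto).
  assert (Ih : locally x (fun u => ball (h x) e (h u))) by (apply Hh; exists e; auto).
  unfold filtermap.
  generalize (filter_and _ _ Ig Ih); apply filter_imp.
  intros u [H1 H2]; apply He; split; assumption.
Qed.

(** * Smooth fields: differentiation under the mean and exchange of derivatives *)

Lemma smooth_partial (a : axis) (u : field) : smooth u -> smooth (partial a u).
Proof.
  intros Hu l t r mu om Hd.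
  generalize (Hu (l ++ a :: nil)%list t r mu om Hd).
  rewrite fold_right_app; auto.
Qed.

Lemma smooth_ex_partial (a : axis) (u : field) (t r mu om : R) :
  smooth u -> dom r mu om -> ex_partial a u t r mu om.
Proof. intros Hu Hd; exact (proj2 (Hu nil t r mu om Hd) a). Qed.

Lemma smooth_continuous_along {U : UniformSpace} (u : field) (gt gr gm go : U -> R)
  (x : U) :
  smooth u -> dom (gr x) (gm x) (go x) ->
  continuous gt x -> continuous gr x -> continuous gm x -> continuous go x ->
  continuous (fun z => u (gt z) (gr z) (gm z) (go z)) x.
Proof.
  intros Hu Hd Ht Hr Hm Ho.
  apply (continuous_comp (fun z => (gt z, (gr z, (gm z, go z))))
    (fun p : R * (R * (R * R)) =>
       u (fst p) (fst (snd p)) (fst (snd (snd p))) (snd (snd (snd p))))).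
  - repeat apply continuous_pair; assumption.
  - exact (proj1 (Hu nil (gt x) (gr x) (gm x) (go x) Hd)).
Qed.

Lemma continuity_2d_pt_of_continuous (g : R -> R -> R) (x y : R) :
  continuous (fun z : R * R => g (fst z) (snd z)) (x, y) -> continuity_2d_pt g x y.
Proof. intros H; apply continuity_2d_pt_filterlim; exact H. Qed.

Lemma smooth_ex_RInt (u : field) (t r om : R) :
  smooth u -> 0 < r -> 0 < om -> ex_RInt (fun mu => u t r mu om) (-1) 1.
Proof.
  intros Hu Hr Ho; apply (ex_RInt_continuous (V := R_CompleteNormedModule)).
  intros z Hz; rewrite Rmin_left, Rmax_right in Hz by lra.
  apply (smooth_continuous_along u (fun _ => t) (fun _ => r) (fun m => m) (fun _ => om));
    try apply continuous_const; try apply continuous_id; auto.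
  repeat split; simpl; lra.
Qed.

(** Differentiation under the integral needs the derivative to be continuous in (t, mu) jointly, up
    to the endpoints of [-1, 1]; the joint continuity in [smooth] supplies this. *)
Lemma is_derive_t_mean (u : field) (t r mu om : R) :
  smooth u -> 0 < r -> 0 < om ->
  is_derive (fun s => mean u s r mu om) t (mean (d_t u) t r mu om).
Proof.
  intros Hu Hr Ho.
  apply is_derive_scal.
  apply (is_derive_RInt_param (fun s m => u s r m om) (-1) 1 t).
  - apply filter_forall; intros s m Hm; rewrite Rmin_left, Rmax_right in Hm by lra.
    apply (smooth_ex_partial axis_t); [auto | repeat split; lra].
  - intros m Hm; rewrite Rmin_left, Rmax_right in Hm by lra.
    apply continuity_2d_pt_of_continuous.
    apply (smooth_continuous_along (partial axis_t u) fst (fun _ => r) snd (fun _ => om));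
      try apply continuous_const; try apply continuous_fst; try apply continuous_snd.
    + apply smooth_partial; auto.
    + repeat split; simpl; lra.
  - apply filter_forall; intros s; apply smooth_ex_RInt; auto.
Qed.

Lemma is_derive_r_mean (u : field) (t r mu om : R) :
  smooth u -> 0 < r -> 0 < om ->
  is_derive (fun s => mean u t s mu om) r (mean (d_r u) t r mu om).
Proof.
  intros Hu Hr Ho.
  apply is_derive_scal.
  apply (is_derive_RInt_param (fun s m => u t s m om) (-1) 1 r).
  - apply filter_imp with (2 := locally_pos r Hr).
    intros s Hs m Hm; rewrite Rmin_left, Rmax_right in Hm by lra.
    apply (smooth_ex_partial axis_r); [auto | repeat split; lra].
  - intros m Hm; rewrite Rmin_left, Rmax_right in Hm by lra.
    apply continuity_2d_pt_of_continuous.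
    apply (smooth_continuous_along (partial axis_r u) (fun _ => t) fst snd (fun _ => om));
      try apply continuous_const; try apply continuous_fst; try apply continuous_snd.
    + apply smooth_partial; auto.
    + repeat split; simpl; lra.
  - apply filter_imp with (2 := locally_pos r Hr).
    intros s Hs; apply smooth_ex_RInt; auto.
Qed.

Lemma smooth_schwarz_t_r (u : field) (t r mu om : R) :
  smooth u -> dom r mu om -> d_t (d_r u) t r mu om = d_r (d_t u) t r mu om.
Proof.
  intros Hu (Hr & Hm & Ho).
  apply (Schwarz (fun s x => u s x mu om) t r).
  - apply locally_2d_impl with (fun _ x => 0 < x).
    + apply locally_2d_forall; intros s x Hx.
      assert (Hd : dom x mu om) by (repeat split; lra).
      repeat split.
      * apply (smooth_ex_partial axis_t); auto.
      * apply (smooth_ex_partial axis_r); auto.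
      * apply (smooth_ex_partial axis_t (partial axis_r u)); auto using smooth_partial.
      * apply (smooth_ex_partial axis_r (partial axis_t u)); auto using smooth_partial.
    + exists (mkposreal r Hr); intros s x _ Hx; simpl in Hx.
      apply Rabs_def2 in Hx; lra.
  - apply continuity_2d_pt_of_continuous.
    apply (smooth_continuous_along (partial axis_t (partial axis_r u)) fst snd
      (fun _ => mu) (fun _ => om));
      try apply continuous_const; try apply continuous_fst; try apply continuous_snd;
      auto using smooth_partial; repeat split; simpl; lra.
  - apply continuity_2d_pt_of_continuous.
    apply (smooth_continuous_along (partial axis_r (partial axis_t u)) fst snd
      (fun _ => mu) (fun _ => om));
      try apply continuous_const; try apply continuous_fst; try apply continuous_snd;
      auto using smooth_partial; repeat split; simpl; lra.
Qed.

Lemma smooth_iter_d_r (k : nat) (u : field) : smooth u -> smooth (Nat.iter k d_r u).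
Proof.
  intros Hu; induction k as [|k IH]; [exact Hu | exact (smooth_partial axis_r _ IH)].
Qed.

Lemma d_t_iter_d_r (k : nat) (u : field) (t r mu om : R) :
  smooth u -> dom r mu om ->
  d_t (Nat.iter k d_r u) t r mu om = Nat.iter k d_r (d_t u) t r mu om.
Proof.
  intros Hu; revert t r; induction k as [|k IH]; intros t r Hd; [reflexivity|].
  simpl; rewrite smooth_schwarz_t_r by auto using smooth_iter_d_r.
  unfold d_r at 1 3; apply Derive_ext_loc.
  destruct Hd as (Hr & Hm & Ho).
  apply filter_imp with (2 := locally_pos r Hr); intros s Hs.
  apply IH; repeat split; lra.
Qed.

Lemma Derive_n_r_mean (k : nat) (u : field) (t r mu om : R) :
  smooth u -> 0 < r -> 0 < om ->
  Derive_n (fun s => mean u t s mu om) k r = mean (Nat.iter k d_r u) t r mu om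
  /\ ex_derive_n (fun s => mean u t s mu om) k r.
Proof.
  intros Hu Hr Ho; revert r Hr; induction k as [|k IH]; intros r Hr; [split; simpl; auto|].
  assert (He : locally r (fun s => Derive_n (fun s => mean u t s mu om) k s
                                   = mean (Nat.iter k d_r u) t s mu om)).
  { apply filter_imp with (2 := locally_pos r Hr); intros s Hs; apply IH; auto. }
  pose proof (is_derive_r_mean (Nat.iter k d_r u) t r mu om (smooth_iter_d_r k u Hu) Hr Ho)
    as D.
  split.
  - simpl; rewrite (Derive_ext_loc _ _ _ He); apply is_derive_unique; exact D.
  - simpl; eapply ex_derive_ext_loc; [|eexists; exact D].
    revert He; apply filter_imp; intros s Hs; symmetry; exact Hs.
Qed.

(** Gives the velocity of each jet coordinate of the beta_i, in the form in which [d_t_part] writes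
    it; d_t is moved past k radial derivatives inside the mean. *)
Lemma is_derive_t_Derive_n_mean (k : nat) (u : field) (t r mu om : R) :
  smooth u -> 0 < r -> 0 < om ->
  is_derive (fun s => Derive_n (fun x => mean u s x mu om) k r) t
            (Derive_n (fun x => d_t (mean u) t x mu om) k r).
Proof.
  intros Hu Hr Ho.
  apply is_derive_ext with (fun s => mean (Nat.iter k d_r u) s r mu om).
  { intros s; symmetry; apply Derive_n_r_mean; auto. }
  replace (Derive_n (fun x => d_t (mean u) t x mu om) k r)
    with (mean (d_t (Nat.iter k d_r u)) t r mu om).
  { apply is_derive_t_mean; auto using smooth_iter_d_r. }
  transitivity (mean (Nat.iter k d_r (d_t u)) t r mu om).
  - unfold mean; f_equal; apply RInt_ext; intros m Hm.
    rewrite Rmin_left, Rmax_right in Hm by lra.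
    apply d_t_iter_d_r; [auto | repeat split; lra].
  - rewrite <- (proj1 (Derive_n_r_mean k (d_t u) t r mu om (smooth_partial axis_t u Hu) Hr Ho)).
    apply Derive_n_ext_loc, filter_imp with (2 := locally_pos r Hr); intros s Hs.
    symmetry; apply is_derive_unique, is_derive_t_mean; auto.
Qed.

(** * Finite double sums, Cauchy products and termwise integration *)

Lemma sum_n_triangle (a : nat -> nat -> R) (n : nat) :
  sum_n (fun i => sum_n (fun l => a l (i - l)%nat) i) n
  = sum_n (fun l => sum_n (fun j => a l j) (n - l)) n.
Proof.
  induction n as [|n IH]; [rewrite !sum_O; reflexivity|].
  rewrite !sum_Sn, IH, Nat.sub_diag, sum_O.
  (* Passing to n + 1 adds one antidiagonal: each old row gains its last entry, and row n + 1 starts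
     with a single one. *)
  rewrite (sum_n_ext_loc (fun l => sum_n (fun j => a l j) (S n - l))
    (fun l => plus (sum_n (fun j => a l j) (n - l)) (a l (S n - l)%nat))).
  - rewrite sum_n_plus; apply plus_assoc.
  - intros l Hl; replace (S n - l)%nat with (S (n - l)) by lia; cbv beta.
    apply sum_Sn.
Qed.

Lemma PS_mult_eps_sum (b : nat -> nat -> R) (P : nat -> R) (m : nat) :
  PS_mult (fun p => sum_n (fun i => b i (p - i)%nat) p) P m
  = sum_n (fun i => PS_mult (b i) P (m - i)) m.
Proof.
  (* [c i j] takes eps^i from the outer sum, eps^j from [b i] and the rest from [P]; both sides add
     it over i + j <= m. *)
  pose (c := fun i j => b i j * P (m - (i + j))%nat).
  unfold PS_mult; rewrite <- sum_n_Reals.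
  transitivity (sum_n (fun p => sum_n (fun i => c i (p - i)%nat) p) m).
  - apply sum_n_ext_loc; intros p Hp.
    rewrite <- (sum_n_mult_r (K := R_Ring)); apply sum_n_ext_loc; intros i Hi.
    unfold c, mult; simpl; do 2 f_equal; lia.
  - rewrite sum_n_triangle; apply sum_n_ext; intros i; rewrite <- sum_n_Reals.
    apply sum_n_ext; intros j; unfold c; do 2 f_equal; lia.
Qed.

Lemma Series_sum_n (a : nat -> nat -> R) (n : nat) :
  (forall i, ex_series (a i)) ->
  Series (fun k => sum_n (fun i => a i k) n) = sum_n (fun i => Series (a i)) n.
Proof.
  intros Ha; apply is_series_unique.
  induction n as [|n IH].
  - rewrite sum_O; apply is_series_ext with (a 0%nat); [intros k; rewrite sum_O; auto|].
    apply Series_correct, Ha.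
  - rewrite sum_Sn.
    apply is_series_ext with (fun k => plus (sum_n (fun i => a i k) n) (a (S n) k)).
    + intros k; rewrite sum_Sn; reflexivity.
    + apply (is_series_plus (V := R_NormedModule)); [exact IH | apply Series_correct, Ha].
Qed.

Lemma is_RInt_sum_n (a : nat -> R -> R) (n : nat) (x y : R) :
  (forall i, (i <= n)%nat -> ex_RInt (a i) x y) ->
  is_RInt (fun s => sum_n (fun i => a i s) n) x y (sum_n (fun i => RInt (a i) x y) n).
Proof.
  induction n as [|n IH]; intros Ha.
  - rewrite sum_O; apply is_RInt_ext with (a 0%nat); [intros s _; rewrite sum_O; auto|].
    apply (RInt_correct (V := R_CompleteNormedModule)); auto.
  - rewrite sum_Sn.
    apply is_RInt_ext with (fun s => plus (sum_n (fun i => a i s) n) (a (S n) s)).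
    + intros s _; rewrite sum_Sn; reflexivity.
    + apply (is_RInt_plus (V := R_NormedModule)); [apply IH; auto|].
      apply (RInt_correct (V := R_CompleteNormedModule)); auto.
Qed.

Lemma mean_sum_n (a : nat -> field) (n : nat) (t r mu om : R) :
  (forall i, (i <= n)%nat -> ex_RInt (fun m => a i t r m om) (-1) 1) ->
  mean (fun t r mu om => sum_n (fun i => a i t r mu om) n) t r mu om
  = sum_n (fun i => mean (a i) t r mu om) n.
Proof.
  intros Ha; unfold mean.
  rewrite (is_RInt_unique _ _ _ _ (is_RInt_sum_n (fun i m => a i t r m om) n (-1) 1 Ha)).
  symmetry; apply (sum_n_mult_l (K := R_Ring)).
Qed.

(** * The chain rule along the jet of beta *)

Lemma jet_differentiable_ex_series (phi : jet -> nat -> R) (y d : jet) (n : nat) :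
  jet_differentiable phi y ->
  ex_series (fun k => PS_mult (d k) (jet_partial k phi y) n).
Proof.
  intros H.
  (* Along the straight line through y every direction [d] is a velocity, so the convergence clause
     of [jet_differentiable] covers it. *)
  apply (H (fun s k p => y k p + s * d k p) d 0).
  - apply functional_extensionality; intros k; apply functional_extensionality; intros p.
    ring.
  - intros k p; auto_derive; [auto | ring].
Qed.

Lemma Derive_n_sum_n (g : nat -> R -> R) (k N : nat) (r : R) :
  (forall i j x, 0 < x -> ex_derive_n (g i) j x) -> 0 < r ->
  Derive_n (fun x => sum_n (fun i => g i x) N) k r
  = sum_n (fun i => Derive_n (g i) k r) N.
Proof.
  intros Hg Hr.
  assert (Hex : forall n j x, 0 < x -> ex_derive_n (fun x => sum_n (fun i => g i x) n) j x).
  { induction n as [|n IH]; intros j x Hx.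
    - apply ex_derive_n_ext with (g 0%nat); [intros z; rewrite sum_O; reflexivity | auto].
    - apply ex_derive_n_ext with (fun x => sum_n (fun i => g i x) n + g (S n) x).
      + intros z; rewrite sum_Sn; reflexivity.
      + apply ex_derive_n_plus; apply filter_imp with (2 := locally_pos x Hx); auto. }
  induction N as [|N IH].
  - rewrite sum_O; apply Derive_n_ext; intros x; rewrite sum_O; reflexivity.
  - rewrite sum_Sn, <- IH.
    rewrite (Derive_n_ext (fun x => sum_n (fun i => g i x) (S N))
      (fun x => sum_n (fun i => g i x) N + g (S N) x))
      by (intros x; rewrite sum_Sn; reflexivity).
    apply Derive_n_plus; apply filter_imp with (2 := locally_pos r Hr); auto.
Qed.

(** The jet of beta moves with the sum of the velocities eps^i d_t beta_i, and the chain rule is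
    linear in the velocity, so it splits into the contributions of the single beta_i. The factor
    eps^i accounts for the index m - i. *)
Lemma d_t_functional (F : nat -> functional) (beta : nat -> R -> R -> R -> R)
  (f : nat -> nat -> field)
  (f_smooth : forall i n, smooth (f i n))
  (beta_mean : forall n t r mu om, dom r mu om ->
     beta n t r om = mean (eps_sum_field 0 f n) t r mu om)
  (Henskog : enskog_postulate F beta f) (l m : nat) (t r mu om : R) :
  dom r mu om ->
  d_t (f l m) t r mu om
  = sum_n (fun i => d_t_part F beta f i l (m - i) t r mu om) m.
Proof.
  intros Hd; destruct Hd as (Hr & Hm & Ho); destruct Henskog as (Hf & Hj & _).
  assert (Hd : dom r mu om) by (repeat split; tauto).
  assert (Hb : forall k p, is_derive (fun s => jet_at beta s r om k p) t
    (sum_n (fun i => Derive_n (fun s => d_t (mean (f i (p - i)%nat)) t s mu om) k r) p)).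
  { intros k p.
    apply is_derive_ext with (fun s =>
      sum_n (fun i => Derive_n (fun x => mean (f i (p - i)%nat) s x mu om) k r) p).
    - intros s; unfold jet_at.
      rewrite (Derive_n_ext_loc (fun x => beta p s x om)
        (fun x => sum_n (fun i => mean (f i (p - i)%nat) s x mu om) p)).
      + symmetry; apply (Derive_n_sum_n (fun i x => mean (f i (p - i)%nat) s x mu om));
          [|exact Hr].
        intros i j x Hx; apply Derive_n_r_mean; auto.
      + apply filter_imp with (2 := locally_pos r Hr); intros x Hx.
        rewrite (beta_mean p s x mu om) by (repeat split; lra).
        apply (mean_sum_n (fun i => f i (p - i)%nat)).
        intros i _; apply smooth_ex_RInt; auto.
    - apply (is_derive_sum_n (K := R_AbsRing) (V := R_NormedModule)
        (fun i s => Derive_n (fun x => mean (f i (p - i)%nat) s x mu om) k r)).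
      intros i _; apply is_derive_t_Derive_n_mean; auto. }
  destruct (Hj l t r mu om Hd (fun s => jet_at beta s r om) _ t eq_refl Hb m) as [_ D].
  unfold d_t at 1.
  rewrite (Derive_ext _ (fun s => F l r mu om (jet_at beta s r om) m))
    by (intros s; apply Hf; exact Hd).
  etransitivity; [apply is_derive_unique; exact D|].
  unfold d_t_part; rewrite <- Series_sum_n.
  - apply Series_ext; intros k.
    apply (PS_mult_eps_sum
      (fun i p => Derive_n (fun s => d_t (mean (f i p)) t s mu om) k r)).
  (* Splitting the series needs convergence for each beta_i separately, which convergence of the
     total does not give. *)
  - intros i; apply (jet_differentiable_ex_series _ _
      (fun k p => Derive_n (fun s => d_t (mean (f i p)) t s mu om) k r)); auto.
Qed.

(** * Moments in mu and inversion of the collision operator *)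

Lemma is_RInt_quartic (a0 a1 a2 a3 a4 : R) :
  is_RInt (fun m => a0 + a1 * m + a2 * m ^ 2 + a3 * m ^ 3 + a4 * m ^ 4) (-1) 1
    (2 * (a0 + a2 / 3 + a4 / 5)).
Proof.
  pose (P m := a0 * m + a1 * m ^ 2 / 2 + a2 * m ^ 3 / 3 + a3 * m ^ 4 / 4
               + a4 * m ^ 5 / 5).
  replace (2 * (a0 + a2 / 3 + a4 / 5)) with (minus (P 1) (P (-1)))
    by (unfold P, minus, plus, opp; simpl; field).
  apply (is_RInt_derive (V := R_CompleteNormedModule) P); intros x _.
  - unfold P; auto_derive; [auto | simpl; field].
  - apply (ex_derive_continuous (V := R_NormedModule)); auto_derive; auto.
Qed.

Lemma mean_ext (u w : field) (t r mu om : R) :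
  (forall m, -1 < m < 1 -> u t r m om = w t r m om) ->
  mean u t r mu om = mean w t r mu om.
Proof.
  intros H; unfold mean; f_equal; apply RInt_ext; intros m Hm.
  rewrite Rmin_left, Rmax_right in Hm by lra; auto.
Qed.

(** Degree four suffices because [Dplus] and [Dminus] raise the mu-degree of a quadratic field by at
    most two. *)
Lemma mean_quartic (u : field) (t r mu om a0 a1 a2 a3 a4 : R) :
  (forall m, -1 < m < 1 ->
     u t r m om = a0 + a1 * m + a2 * m ^ 2 + a3 * m ^ 3 + a4 * m ^ 4) ->
  mean u t r mu om = a0 + a2 / 3 + a4 / 5.
Proof.
  intros H.
  rewrite (mean_ext u (fun _ _ m _ => a0 + a1 * m + a2 * m ^ 2 + a3 * m ^ 3 + a4 * m ^ 4))
    by exact H.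
  unfold mean; rewrite (is_RInt_unique _ _ _ _ (is_RInt_quartic a0 a1 a2 a3 a4)); field.
Qed.

Lemma is_RInt_scal_plus (g p : R -> R) (a ip x y : R) :
  ex_RInt g x y -> is_RInt p x y ip ->
  is_RInt (fun m => a * g m + p m) x y (a * RInt g x y + ip).
Proof.
  intros Hg Hp.
  apply (is_RInt_plus (V := R_NormedModule) (fun m => a * g m)); [|exact Hp].
  apply (is_RInt_scal (V := R_NormedModule) g).
  apply (RInt_correct (V := R_CompleteNormedModule)); exact Hg.
Qed.

(** On average the phi0 gain and loss cancel and the phi1 term is odd, so only absorption is
    left. *)
Lemma is_RInt_Jbar (M : medium) (u : field) (t r mu om : R) :
  smooth u -> 0 < r -> 0 < om ->
  is_RInt (fun m => Jbar M u t r m om) (-1) 1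
    (2 * (- chitbar M t r om * mean u t r mu om)).
Proof.
  intros Hu Hr Ho.
  set (k := 3 * phi1bar M t r om * mean (fun t r mu om => u t r mu om * mu) t r mu om).
  replace (2 * (- chitbar M t r om * mean u t r mu om))
    with (- (chitbar M t r om + phi0bar M t r om) * RInt (fun m => u t r m om) (-1) 1
          + 2 * (phi0bar M t r om * mean u t r mu om + 0 / 3 + 0 / 5))
    by (unfold mean; field).
  apply is_RInt_ext with (fun m =>
    - (chitbar M t r om + phi0bar M t r om) * u t r m om
    + (phi0bar M t r om * mean u t r mu om + k * m + 0 * m ^ 2 + 0 * m ^ 3 + 0 * m ^ 4)).
  - intros m _; unfold Jbar, Cbar.
    (* [mean] ignores its mu argument, so both changes hold by conversion. *)
    change (mean u t r m om) with (mean u t r mu om).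
    change (mean (fun t r mu om => u t r mu om * mu) t r m om)
      with (mean (fun t r mu om => u t r mu om * mu) t r mu om).
    eq_in_R; unfold k; ring.
  - apply is_RInt_scal_plus; [apply smooth_ex_RInt; auto | apply is_RInt_quartic].
Qed.

Lemma mean_Jbar (M : medium) (u : field) (t r mu om : R) :
  smooth u -> 0 < r -> 0 < om ->
  mean (Jbar M u) t r mu om = - chitbar M t r om * mean u t r mu om.
Proof.
  intros Hu Hr Ho; unfold mean at 1.
  rewrite (is_RInt_unique _ _ _ _ (is_RInt_Jbar M u t r mu om Hu Hr Ho)); field.
Qed.

(** After multiplication by mu the isotropic gain is odd, and the factor 3 offsets the mean 1/3 of
    mu^2; hence the multiplier -1/lambar. *)
Lemma mean_mu_Jbar (M : medium) (u : field) (t r mu om : R) :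
  smooth u -> 0 < r -> 0 < om ->
  mean (fun t r mu om => Jbar M u t r mu om * mu) t r mu om
  = - (chitbar M t r om + phi0bar M t r om - phi1bar M t r om)
    * mean (fun t r mu om => u t r mu om * mu) t r mu om.
Proof.
  intros Hu Hr Ho; unfold mean at 1.
  rewrite (RInt_ext _ (fun m =>
    - (chitbar M t r om + phi0bar M t r om) * (u t r m om * m)
    + (0 + phi0bar M t r om * mean u t r mu om * m
       + 3 * phi1bar M t r om * mean (fun t r mu om => u t r mu om * mu) t r mu om * m ^ 2
       + 0 * m ^ 3 + 0 * m ^ 4))).
  - erewrite is_RInt_unique;
      [| apply (is_RInt_scal_plus (fun m => u t r m om * m)); [|apply is_RInt_quartic]].
    + unfold mean; field.
    + apply (ex_RInt_continuous (V := R_CompleteNormedModule)).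
      intros z Hz; rewrite Rmin_left, Rmax_right in Hz by lra.
      apply (continuous_mult (K := R_AbsRing) (fun m => u t r m om) (fun m => m));
        [|apply continuous_id].
      apply (smooth_continuous_along u (fun _ => t) (fun _ => r) (fun m => m)
        (fun _ => om)); try apply continuous_const; try apply continuous_id; auto.
      repeat split; simpl; lra.
  - intros m _; unfold Jbar, Cbar.
    change (mean u t r m om) with (mean u t r mu om).
    change (mean (fun t r mu om => u t r mu om * mu) t r m om)
      with (mean (fun t r mu om => u t r mu om * mu) t r mu om).
    eq_in_R; ring.
Qed.

(** Obtained by solving s = Jbar u for u, with the moments of u expressed by those of s: mean u =
    -(mean s)/chitbar and mean (mu u) = -lambar mean (mu s). Up to the shift by eps, [neglected] is
    then mean (Dplus (Jbar_inv (Dplus f_0))) by conversion. *)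
Definition Jbar_inv (M : medium) (g : field) : field := fun t r mu om =>
  - 1 / (chitbar M t r om + phi0bar M t r om)
  * (g t r mu om
     + phi0bar M t r om / chitbar M t r om * mean g t r mu om
     + 3 * mu * phi1bar M t r om * lambar M t r om
       * mean (fun t r mu om => g t r mu om * mu) t r mu om).

Lemma Jbar_inv_correct (M : medium) (u s : field) (t r mu om : R) :
  chitbar M t r om <> 0 ->
  chitbar M t r om + phi0bar M t r om <> 0 ->
  chitbar M t r om + phi0bar M t r om - phi1bar M t r om <> 0 ->
  smooth u -> dom r mu om ->
  (forall m, -1 <= m <= 1 -> s t r m om = Jbar M u t r m om) ->
  u t r mu om = Jbar_inv M s t r mu om.
Proof.
  intros H1 H2 H3 Hu (Hr & Hm & Ho) Hs; unfold Jbar_inv.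
  rewrite (mean_ext s (Jbar M u)) by (intros; apply Hs; lra).
  rewrite (mean_ext (fun t r mu om => s t r mu om * mu)
    (fun t r mu om => Jbar M u t r mu om * mu)) by (intros; rewrite Hs by lra; reflexivity).
  rewrite mean_Jbar, mean_mu_Jbar, Hs by assumption.
  unfold Jbar, Cbar, lambar; field; auto.
Qed.

(** The coefficient of mu collapses to lambar because 1 + phi1bar lambar = (chitbar + phi0bar)
    lambar. *)
Lemma Jbar_inv_quadratic (M : medium) (g : field) (t r mu om e b c : R) :
  chitbar M t r om + phi0bar M t r om <> 0 ->
  chitbar M t r om + phi0bar M t r om - phi1bar M t r om <> 0 ->
  -1 <= mu <= 1 ->
  (forall m, -1 <= m <= 1 -> g t r m om = e + b * m + c * m ^ 2) ->
  Jbar_inv M g t r mu om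
  = - (e + phi0bar M t r om / chitbar M t r om * (e + c / 3))
      / (chitbar M t r om + phi0bar M t r om)
    + mu * (- lambar M t r om * b)
    + mu ^ 2 * (- c / (chitbar M t r om + phi0bar M t r om)).
Proof.
  intros H2 H3 Hm Hg; unfold Jbar_inv.
  rewrite (mean_quartic g _ _ _ _ e b c 0 0) by (intros; rewrite Hg by lra; ring).
  rewrite (mean_quartic (fun t r mu om => g t r mu om * mu) _ _ _ _ 0 e b c 0)
    by (intros; rewrite Hg by lra; ring).
  rewrite Hg by lra; unfold lambar.
  (* With the quotient opaque, [field] does not ask for chitbar to be nonzero. *)
  generalize (phi0bar M t r om / chitbar M t r om); intros x; field; auto.
Qed.

(** * Fields quadratic in mu under D^+ and D^- *)

Lemma partial_ext_dom (a : axis) (u w : field) (t r mu om : R) :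
  a <> axis_mu ->
  (forall t r mu om, dom r mu om -> u t r mu om = w t r mu om) ->
  dom r mu om -> partial a u t r mu om = partial a w t r mu om.
Proof.
  (* [dom] is open in t, r and omega but closed in mu, so agreement near the point is available only
     for the first three. *)
  intros Ha H (Hr & Hm & Ho); destruct a; [| |contradiction|]; simpl; apply Derive_ext_loc.
  - apply filter_forall; intros s; apply H; repeat split; lra.
  - apply filter_imp with (2 := locally_pos r Hr); intros s Hs; apply H; repeat split; lra.
  - apply filter_imp with (2 := locally_pos om Ho); intros s Hs; apply H; repeat split; lra.
Qed.

Lemma Derive_quadratic (a b c : R -> R) (m x : R) :
  ex_derive a x -> ex_derive b x -> ex_derive c x ->
  Derive (fun s => a s + m * b s + m ^ 2 * c s) x
  = Derive a x + m * Derive b x + m ^ 2 * Derive c x.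
Proof. 
  intros Ha Hb Hc; apply is_derive_unique; auto_derive; [auto|].
  change (Derive (fun s => a s)) with (Derive a); change (Derive (fun s => b s)) with (Derive b);
  change (Derive (fun s => c s)) with (Derive c); ring.
Qed.

(** The value mu = 0 is arbitrary, as [iso g] is constant in mu. *)
Definition differentiable_at (g : R -> R -> R -> R) (t r om : R) : Prop :=
  forall a, ex_partial a (iso g) t r 0 om.

Definition quadratic_in_mu (u : field) (E q G : R -> R -> R -> R) : Prop :=
  forall t r mu om, dom r mu om ->
    u t r mu om = E t r om + mu * q t r om + mu ^ 2 * G t r om.

Lemma partial_quadratic (a : axis) (u : field) (E q G : R -> R -> R -> R)
  (t r mu om : R) :
  a <> axis_mu ->
  quadratic_in_mu u E q G -> dom r mu om ->
  differentiable_at E t r om -> differentiable_at q t r om -> differentiable_at G t r om ->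
  partial a u t r mu om
  = partial a (iso E) t r 0 om + mu * partial a (iso q) t r 0 om
    + mu ^ 2 * partial a (iso G) t r 0 om.
Proof.
  intros Ha Hu Hd HE Hq HG.
  rewrite (partial_ext_dom a u
    (fun t r mu om => E t r om + mu * q t r om + mu ^ 2 * G t r om)) by auto.
  specialize (HE a); specialize (Hq a); specialize (HG a).
  destruct a; [| |contradiction|]; apply Derive_quadratic; assumption.
Qed.

(** The weight vanishes at mu = 1 and -1, where [u] may deviate from the quadratic on the far side;
    in the interior the formula holds near mu and can be differentiated. *)
Lemma d_mu_quadratic (u : field) (E q G : R -> R -> R -> R) (t r mu om : R) :
  quadratic_in_mu u E q G -> dom r mu om ->
  (1 - mu ^ 2) * d_mu u t r mu om = (1 - mu ^ 2) * (q t r om + 2 * mu * G t r om).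
Proof.
  intros Hu (Hr & Hm & Ho).
  destruct (Req_dec (1 - mu ^ 2) 0) as [H0|H0]; [rewrite H0; ring|].
  f_equal; unfold d_mu.
  rewrite (Derive_ext_loc _ (fun s => E t r om + s * q t r om + s ^ 2 * G t r om)).
  - apply is_derive_unique; auto_derive; auto; ring.
  - apply filter_imp with (P := fun s => -1 <= s <= 1).
    + intros s Hs; apply Hu; repeat split; lra.
    + apply locally_open_interval.
      assert (mu <> -1) by (intros ->; apply H0; ring).
      assert (mu <> 1) by (intros ->; apply H0; ring).
      lra.
Qed.

Lemma Dplus_quadratic (M : medium) (u : field) (E q G : R -> R -> R -> R)
  (t r mu om : R) :
  let A := dlnrho M t r 0 om + 3 * vel M t r / (light M * r) in
  let V := vel M t r / (light M * r) in
  quadratic_in_mu u E q G -> dom r mu om ->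
  differentiable_at E t r om -> differentiable_at q t r om -> differentiable_at G t r om ->
  Dplus M u t r mu om
  = (Ddt M (iso E) t r 0 om + mu * Ddt M (iso q) t r 0 om
     + mu ^ 2 * Ddt M (iso G) t r 0 om) / light M
    + mu * A * ((1 - mu ^ 2) * (q t r om + 2 * mu * G t r om))
    + (mu ^ 2 * A - V) * om
      * (d_om (iso E) t r 0 om + mu * d_om (iso q) t r 0 om
         + mu ^ 2 * d_om (iso G) t r 0 om).
Proof.
  intros A V Hu Hd HE Hq HG; unfold Dplus.
  change (dlnrho M t r mu om) with (dlnrho M t r 0 om); fold A V.
  rewrite (Rmult_assoc (mu * A)), (d_mu_quadratic u E q G) by assumption.
  unfold Ddt.
  change d_t with (partial axis_t); change d_r with (partial axis_r);
  change d_om with (partial axis_om).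
  rewrite !(partial_quadratic _ u E q G) by (discriminate || assumption).
  unfold Rdiv; ring.
Qed.

Lemma Dminus_quadratic (M : medium) (u : field) (E q G : R -> R -> R -> R)
  (t r mu om : R) :
  quadratic_in_mu u E q G -> dom r mu om ->
  differentiable_at E t r om -> differentiable_at q t r om -> differentiable_at G t r om ->
  Defs.Dminus M u t r mu om
  = mu * (d_r (iso E) t r 0 om + mu * d_r (iso q) t r 0 om
          + mu ^ 2 * d_r (iso G) t r 0 om)
    + 1 / r * ((1 - mu ^ 2) * (q t r om + 2 * mu * G t r om)).
Proof.
  intros Hu Hd HE Hq HG; unfold Defs.Dminus.
  rewrite (Rmult_assoc (1 / r)), (d_mu_quadratic u E q G) by assumption.
  change d_r with (partial axis_r).
  rewrite (partial_quadratic _ u E q G) by (discriminate || assumption).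
  reflexivity.
Qed.

(** q is absent because [Dplus] preserves parity in mu, so that q meets odd powers only. The
    constant 4/15 = 2 (1/3 - 1/5) is the mean of 2 mu^2 (1 - mu^2). *)
Lemma mean_Dplus_quadratic (M : medium) (u : field) (E q G : R -> R -> R -> R)
  (t r mu om : R) :
  let A := dlnrho M t r 0 om + 3 * vel M t r / (light M * r) in
  let V := vel M t r / (light M * r) in
  quadratic_in_mu u E q G -> 0 < r -> 0 < om ->
  differentiable_at E t r om -> differentiable_at q t r om -> differentiable_at G t r om ->
  mean (Dplus M u) t r mu om
  = (Ddt M (iso E) t r 0 om + Ddt M (iso G) t r 0 om / 3) / light M
    + 4 / 15 * A * G t r om
    + om * (A * (d_om (iso E) t r 0 om / 3 + d_om (iso G) t r 0 om / 5)
            - V * (d_om (iso E) t r 0 om + d_om (iso G) t r 0 om / 3)).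
Proof.
  intros A V Hu Hr Ho HE Hq HG.
  rewrite (mean_quartic _ _ _ _ _
    (Ddt M (iso E) t r 0 om / light M - V * om * d_om (iso E) t r 0 om)
    (Ddt M (iso q) t r 0 om / light M + A * q t r om - V * om * d_om (iso q) t r 0 om)
    (Ddt M (iso G) t r 0 om / light M + 2 * A * G t r om
     + A * om * d_om (iso E) t r 0 om - V * om * d_om (iso G) t r 0 om)
    (- A * q t r om + A * om * d_om (iso q) t r 0 om)
    (- 2 * A * G t r om + A * om * d_om (iso G) t r 0 om)).
  - unfold Rdiv; generalize (/ light M); intros; field.
  - intros m Hm; rewrite (Dplus_quadratic M u E q G) by (auto; repeat split; lra).
    fold A V; unfold Rdiv; ring.
Qed.

(** [Dminus] reverses parity, so its mean keeps only q. With means 1/3 of mu^2 and 2/3 of 1 - mu^2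
    the added term is the radial divergence r^-2 d_r (r^2 q) / 3. *)
Lemma mean_Dop_quadratic (M : medium) (u : field) (E q G : R -> R -> R -> R)
  (t r mu om : R) :
  quadratic_in_mu u E q G -> 0 < r -> 0 < om ->
  differentiable_at E t r om -> differentiable_at q t r om -> differentiable_at G t r om ->
  mean (Dop M u) t r mu om
  = mean (Dplus M u) t r mu om + (d_r (iso q) t r 0 om / 3 + 2 / (3 * r) * q t r om).
Proof.
  intros Hu Hr Ho HE Hq HG.
  rewrite (mean_Dplus_quadratic M u E q G) by assumption.
  set (A := dlnrho M t r 0 om + 3 * vel M t r / (light M * r)).
  set (V := vel M t r / (light M * r)).
  rewrite (mean_quartic _ _ _ _ _
    (Ddt M (iso E) t r 0 om / light M - V * om * d_om (iso E) t r 0 om + / r * q t r om)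
    (Ddt M (iso q) t r 0 om / light M + A * q t r om - V * om * d_om (iso q) t r 0 om
     + d_r (iso E) t r 0 om + 2 * / r * G t r om)
    (Ddt M (iso G) t r 0 om / light M + 2 * A * G t r om
     + A * om * d_om (iso E) t r 0 om - V * om * d_om (iso G) t r 0 om
     + d_r (iso q) t r 0 om - / r * q t r om)
    (- A * q t r om + A * om * d_om (iso q) t r 0 om + d_r (iso G) t r 0 om
     - 2 * / r * G t r om)
    (- 2 * A * G t r om + A * om * d_om (iso G) t r 0 om)).
  - unfold Rdiv; generalize (/ light M); intros; field; lra.
  - intros m Hm; unfold Dop.
    rewrite (Dplus_quadratic M u E q G), (Dminus_quadratic M u E q G)
      by (auto; repeat split; lra).
    fold A V; unfold Rdiv; ring.
Qed.

(** * Resummation of the hierarchy into Boltzmann's equation *)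

Lemma partial_eps_sum (a : axis) (f : nat -> nat -> field) (n : nat) (t r mu om : R) :
  (forall i m, smooth (f i m)) -> dom r mu om ->
  partial a (eps_sum_field 0 f n) t r mu om
  = sum_n (fun i => partial a (f i (n - i)%nat) t r mu om) n.
Proof.
  intros Hf Hd.
  assert (H : forall i, ex_partial a (f i (n - i)%nat) t r mu om)
    by (intros i; apply smooth_ex_partial; auto).
  destruct a.
  - apply (Derive_sum_n (fun i s => f i (n - i)%nat s r mu om)); intros i _; apply H.
  - apply (Derive_sum_n (fun i s => f i (n - i)%nat t s mu om)); intros i _; apply H.
  - apply (Derive_sum_n (fun i s => f i (n - i)%nat t r s om)); intros i _; apply H.
  - apply (Derive_sum_n (fun i s => f i (n - i)%nat t r mu s)); intros i _; apply H.
Qed.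

Lemma sum_n_linear_combination (x1 x2 x3 x4 : nat -> R) (a1 a2 a3 a4 : R) (n : nat) :
  sum_n (fun i => a1 * x1 i + a2 * x2 i + a3 * x3 i + a4 * x4 i) n
  = a1 * sum_n x1 n + a2 * sum_n x2 n + a3 * sum_n x3 n + a4 * sum_n x4 n.
Proof.
  induction n as [|n IH]; [rewrite !sum_O; reflexivity|].
  rewrite !sum_Sn, IH; unfold plus; simpl; ring.
Qed.

(** The contribution of beta_j to d_t f_l enters with eps^(l + j). [D_order] groups these terms by i
    = l + j, the true time derivative by l; exchanging the sums over the triangle identifies the
    two. *)
Lemma Dop_eps_sum (M : medium) (F : nat -> functional)
  (beta : nat -> R -> R -> R -> R) (f : nat -> nat -> field)
  (f_smooth : forall i n, smooth (f i n))
  (beta_mean : forall n t r mu om, dom r mu om ->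
     beta n t r om = mean (eps_sum_field 0 f n) t r mu om)
  (Henskog : enskog_postulate F beta f) (n : nat) (t r mu om : R) :
  dom r mu om ->
  Dop M (eps_sum_field 0 f n) t r mu om
  = sum_n (fun i => D_order M F beta f i (n - i) t r mu om) n.
Proof.
  intros Hd.
  pose (a i j := d_t_part F beta f j i (n - (i + j)) t r mu om).
  rewrite (sum_n_ext_loc _ (fun i =>
    / light M * sum_n (fun l => a l (i - l)%nat) i
    + (vel M t r / light M + mu) * d_r (f i (n - i)%nat) t r mu om
    + F_mu M t r mu om * d_mu (f i (n - i)%nat) t r mu om
    + F_om M t r mu om * d_om (f i (n - i)%nat) t r mu om)).
  - rewrite sum_n_linear_combination, (sum_n_triangle a).
    rewrite (sum_n_ext_loc (fun l => sum_n (fun j => a l j) (n - l))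
      (fun l => d_t (f l (n - l)%nat) t r mu om)).
    + change d_t with (partial axis_t); change d_r with (partial axis_r);
      change d_mu with (partial axis_mu); change d_om with (partial axis_om).
      rewrite <- !partial_eps_sum by assumption.
      unfold Dop, Dplus, Defs.Dminus, Ddt, F_mu, F_om.
      simpl partial; unfold Rdiv; ring.
    + intros l Hl.
      rewrite (d_t_functional F beta f f_smooth beta_mean Henskog l (n - l) t r mu om Hd).
      apply sum_n_ext; intros j; unfold a; rewrite Nat.sub_add_distr; reflexivity.
  - intros i Hi; unfold D_order.
    assert (Hs : sum_n (fun l => d_t_part F beta f (i - l) l (n - i) t r mu om / light M) i
                 = / light M * sum_n (fun l => a l (i - l)%nat) i).
    { rewrite <- (sum_n_mult_l (K := R_Ring)); apply sum_n_ext_loc; intros l Hl.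
      unfold a, mult; simpl; unfold Rdiv.
      replace (l + (i - l))%nat with i by lia; apply Rmult_comm. }
    rewrite Hs; eq_in_R; unfold Rdiv; ring.
Qed.

(** The hierarchy pairs D(f)^(i) with f_(i+1); the resulting index [S n] is the factor eps^-1 of
    Boltzmann's equation. *)
Lemma mean_Dop_eps_sum (M : medium) (F : nat -> functional)
  (beta : nat -> R -> R -> R -> R) (f : nat -> nat -> field)
  (f_smooth : forall i n, smooth (f i n))
  (beta_mean : forall n t r mu om, dom r mu om ->
     beta n t r om = mean (eps_sum_field 0 f n) t r mu om)
  (Henskog : enskog_postulate F beta f)
  (Hhierarchy : hierarchy M F beta f) (n : nat) (t r mu om : R) :
  0 < r -> 0 < om ->
  mean (Dop M (eps_sum_field 0 f n)) t r mu om
  = - chitbar M t r om * eps_sum_field 1 (fun i p => mean (f i p)) (S n) t r mu om.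
Proof.
  intros Hr Ho.
  rewrite (mean_ext _ (fun t r mu om =>
    sum_n (fun i => Jbar M (f (S i) (n - i)%nat) t r mu om) n)).
  - rewrite (mean_sum_n (fun i => Jbar M (f (S i) (n - i)%nat))).
    + rewrite (sum_n_ext _ (fun i =>
        mult (- chitbar M t r om) (mean (f (S i) (n - i)%nat) t r mu om)))
        by (intros i; apply mean_Jbar; auto).
      rewrite sum_n_mult_l; unfold eps_sum_field, eps_sum.
      rewrite <- sum_n_m_S; reflexivity.
    + intros i _; eexists; apply (is_RInt_Jbar M _ t r mu om); auto.
  - intros m Hm.
    assert (Hd : dom r m om) by (repeat split; lra).
    rewrite (Dop_eps_sum M F beta f f_smooth beta_mean Henskog n t r m om Hd).
    apply sum_n_ext; intros i; apply (proj2 Hhierarchy); exact Hd.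
Qed.

(** * Regularity of the mu-coefficients, and the first two terms of the expansion *)

Lemma smooth_differentiable_at (u : field) (m t r om : R) :
  smooth u -> -1 <= m <= 1 -> 0 < r -> 0 < om ->
  differentiable_at (fun t r om => u t r m om) t r om.
Proof.
  intros Hu Hm Hr Ho a.
  assert (Hd : dom r m om) by (repeat split; lra).
  destruct a; [| |exact (ex_derive_const (K := R_AbsRing) (V := R_NormedModule) (u t r m om) 0)|].
  - exact (smooth_ex_partial axis_t u t r m om Hu Hd).
  - exact (smooth_ex_partial axis_r u t r m om Hu Hd).
  - exact (smooth_ex_partial axis_om u t r m om Hu Hd).
Qed.

(** Three terms, one for each interpolation node in [quadratic_coefficients]. *)
Lemma differentiable_at_lin (g h k : R -> R -> R -> R) (a b c t r om : R) :
  differentiable_at g t r om -> differentiable_at h t r om -> differentiable_at k t r om ->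
  differentiable_at (fun t r om => a * g t r om + b * h t r om + c * k t r om) t r om.
Proof.
  intros Hg Hh Hk x; specialize (Hg x); specialize (Hh x); specialize (Hk x).
  destruct x; simpl in *; unfold iso in *; auto_derive; auto.
Qed.

Definition zero_profile : R -> R -> R -> R := fun _ _ _ => 0.

Lemma partial_zero (a : axis) (t r mu om : R) : partial a (iso zero_profile) t r mu om = 0.
Proof. destruct a; exact (Derive_const 0 _). Qed.

Lemma differentiable_at_zero (t r om : R) : differentiable_at zero_profile t r om.
Proof.
  intros a; destruct a; exact (ex_derive_const (K := R_AbsRing) (V := R_NormedModule) 0 _).
Qed.

Lemma Dplus_isotropic (M : medium) (u : field) (B : R -> R -> R -> R) (t r mu om : R) :
  let A := dlnrho M t r 0 om + 3 * vel M t r / (light M * r) in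
  let V := vel M t r / (light M * r) in
  quadratic_in_mu u B zero_profile zero_profile -> dom r mu om -> differentiable_at B t r om ->
  Dplus M u t r mu om
  = Ddt M (iso B) t r 0 om / light M + (mu ^ 2 * A - V) * om * d_om (iso B) t r 0 om.
Proof.
  intros A V Hu Hd HB.
  rewrite (Dplus_quadratic M u B zero_profile zero_profile)
    by auto using differentiable_at_zero.
  fold A V; unfold Ddt.
  change d_t with (partial axis_t); change d_r with (partial axis_r);
  change d_om with (partial axis_om).
  rewrite !partial_zero; unfold zero_profile, Rdiv; ring.
Qed.

Lemma Dminus_isotropic (M : medium) (u : field) (B : R -> R -> R -> R) (t r mu om : R) :
  quadratic_in_mu u B zero_profile zero_profile -> dom r mu om -> differentiable_at B t r om ->
  Defs.Dminus M u t r mu om = mu * d_r (iso B) t r 0 om.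
Proof.
  intros Hu Hd HB.
  rewrite (Dminus_quadratic M u B zero_profile zero_profile) by auto using differentiable_at_zero.
  change d_r with (partial axis_r).
  rewrite !partial_zero; unfold zero_profile; ring.
Qed.

(** The source in the equation for f_0 is constant in mu, where inverting [Jbar] is division by
    -chitbar; it sits at coefficient 0 only. *)
Lemma f0_isotropic (M : medium) (F : nat -> functional)
  (beta : nat -> R -> R -> R -> R) (f : nat -> nat -> field) (n : nat)
  (Hchit : forall t r om, 0 < r -> 0 < om -> chitbar M t r om <> 0)
  (Hphi0 : forall t r om, 0 < r -> 0 < om ->
     chitbar M t r om + phi0bar M t r om <> 0)
  (Hphi1 : forall t r om, 0 < r -> 0 < om ->
     chitbar M t r om + phi0bar M t r om - phi1bar M t r om <> 0)
  (f_smooth : forall i n, smooth (f i n))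
  (Hhierarchy : hierarchy M F beta f) (t r mu om : R) :
  dom r mu om ->
  f 0%nat n t r mu om = (if Nat.eqb n 0 then jbar M t r om else 0) / chitbar M t r om.
Proof.
  intros Hd; destruct Hd as (Hr & Hm & Ho).
  set (j := if Nat.eqb n 0 then jbar M t r om else 0).
  rewrite (Jbar_inv_correct M (f 0%nat n) (fun _ _ _ _ => - j) t r mu om);
    auto; [|repeat split; lra|].
  - rewrite (Jbar_inv_quadratic M _ t r mu om (- j) 0 0) by (auto; intros; ring).
    field; auto.
  - intros m Hm'; unfold j.
    assert (H := proj1 Hhierarchy n t r m om ltac:(repeat split; lra)); lra.
Qed.

(** Lagrange interpolation at mu = 0, 1 and -1: [quadratic_in_mu] asks no regularity of e, b and c,
    which inherit it from u at these nodes. *)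
Lemma quadratic_coefficients (u : field) (e b c : R -> R -> R -> R) (t r om : R) :
  quadratic_in_mu u e b c -> 0 < r -> 0 < om ->
  e t r om = 1 * u t r 0 om + 0 * u t r 1 om + 0 * u t r (-1) om /\
  b t r om = 0 * u t r 0 om + / 2 * u t r 1 om + - / 2 * u t r (-1) om /\
  c t r om = -1 * u t r 0 om + / 2 * u t r 1 om + / 2 * u t r (-1) om.
Proof.
  intros Hu Hr Ho.
  rewrite (Hu t r 0 om), (Hu t r 1 om), (Hu t r (-1) om) by (repeat split; lra).
  repeat split; field.
Qed.

Lemma differentiable_at_ext (g h : R -> R -> R -> R) (t r om : R) :
  (forall t r om, 0 < r -> 0 < om -> g t r om = h t r om) -> 0 < r -> 0 < om ->
  differentiable_at h t r om -> differentiable_at g t r om.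
Proof.
  intros H Hr Ho Hh a; specialize (Hh a); destruct a; simpl in *;
    refine (ex_derive_ext_loc _ _ _ _ Hh); unfold iso.
  - apply filter_forall; intros s; symmetry; auto.
  - apply filter_imp with (2 := locally_pos r Hr); intros s Hs; symmetry; auto.
  - apply filter_forall; intros s; symmetry; auto.
  - apply filter_imp with (2 := locally_pos om Ho); intros s Hs; symmetry; auto.
Qed.

Lemma differentiable_at_coefficients (u : field) (e b c : R -> R -> R -> R) (t r om : R) :
  smooth u -> quadratic_in_mu u e b c -> 0 < r -> 0 < om ->
  differentiable_at e t r om /\ differentiable_at b t r om /\ differentiable_at c t r om.
Proof.
  intros Hs Hu Hr Ho.
  assert (D : forall x y z : R, differentiable_at (fun t r om =>
    x * u t r 0 om + y * u t r 1 om + z * u t r (-1) om) t r om).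
  { intros x y z; apply (differentiable_at_lin (fun t r om => u t r 0 om)
      (fun t r om => u t r 1 om) (fun t r om => u t r (-1) om));
      apply smooth_differentiable_at; auto; lra. }
  repeat split.
  - refine (differentiable_at_ext _ _ _ _ _ _ Hr Ho (D 1 0 0)).
    intros; apply (quadratic_coefficients u e b c); auto.
  - refine (differentiable_at_ext _ _ _ _ _ _ Hr Ho (D 0 (/ 2) (- / 2))).
    intros; apply (quadratic_coefficients u e b c); auto.
  - refine (differentiable_at_ext _ _ _ _ _ _ Hr Ho (D (-1) (/ 2) (/ 2))).
    intros; apply (quadratic_coefficients u e b c); auto.
Qed.

(* The even part of [Jbar_inv M (Dop M u)] is [Jbar_inv M (Dplus M u)], since
   [Dplus M u] is even and [Dminus M u] odd in mu for isotropic u; the odd part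
   carries the radiative flux [- lambar * d_r B]. *)
Lemma Jbar_inv_isotropic (M : medium) (u : field) (B : R -> R -> R -> R)
  (Hphi0 : forall t r om, 0 < r -> 0 < om ->
     chitbar M t r om + phi0bar M t r om <> 0)
  (Hphi1 : forall t r om, 0 < r -> 0 < om ->
     chitbar M t r om + phi0bar M t r om - phi1bar M t r om <> 0) :
  quadratic_in_mu u B zero_profile zero_profile ->
  (forall t r om, 0 < r -> 0 < om -> differentiable_at B t r om) ->
  exists e c,
    quadratic_in_mu (Jbar_inv M (Dop M u)) e
      (fun t r om => - lambar M t r om * d_r (iso B) t r 0 om) c /\
    quadratic_in_mu (Jbar_inv M (Dplus M u)) e zero_profile c.
Proof.
  intros Hu HB.
  pose (A t r om := dlnrho M t r 0 om + 3 * vel M t r / (light M * r)).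
  pose (V t r := vel M t r / (light M * r)).
  pose (e t r om := Ddt M (iso B) t r 0 om / light M - V t r * om * d_om (iso B) t r 0 om).
  pose (c t r om := A t r om * om * d_om (iso B) t r 0 om).
  (* [e] and [c] are the coefficients of 1 and mu^2 in [Dplus M u]; the witnesses are their images
     under [Jbar_inv_quadratic]. *)
  exists (fun t r om =>
    - (e t r om + phi0bar M t r om / chitbar M t r om * (e t r om + c t r om / 3))
      / (chitbar M t r om + phi0bar M t r om)).
  exists (fun t r om => - c t r om / (chitbar M t r om + phi0bar M t r om)).
  split; intros t r mu om (Hr & Hm & Ho).
  - apply Jbar_inv_quadratic; auto.
    intros m Hm'; unfold Dop.
    rewrite (Dplus_isotropic M u B), (Dminus_isotropic M u B) by (auto; repeat split; lra).
    unfold e, c, A, V; ring.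
  - rewrite (Jbar_inv_quadratic M (Dplus M u) t r mu om (e t r om) 0 (c t r om)); auto.
    + unfold zero_profile; ring.
    + intros m Hm'; rewrite (Dplus_isotropic M u B) by (auto; repeat split; lra).
      unfold e, c, A, V; ring.
Qed.

(** The mean 1/3 of mu^2 turns 3v/(cr) into v/(cr), which cancels the last term of F_omega and
    leaves a third of the density term. *)
Lemma mean_Dop_isotropic (M : medium) (u : field) (B : R -> R -> R -> R) (t r mu om : R) :
  quadratic_in_mu u B zero_profile zero_profile -> 0 < r -> 0 < om -> 0 < light M ->
  differentiable_at B t r om ->
  mean (Dop M u) t r mu om
  = Ddt M (iso B) t r mu om / light M
    + 1 / 3 * dlnrho M t r mu om * om * d_om (iso B) t r mu om.
Proof.
  intros Hu Hr Ho Hc HB.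
  rewrite (mean_Dop_quadratic M u B zero_profile zero_profile), (mean_Dplus_quadratic M u B zero_profile zero_profile)
    by auto using differentiable_at_zero.
  unfold Ddt.
  change d_t with (partial axis_t); change d_r with (partial axis_r);
  change d_om with (partial axis_om).
  rewrite !partial_zero; unfold zero_profile.
  change (dlnrho M t r mu om) with (dlnrho M t r 0 om).
  change (partial axis_t (iso B) t r mu om) with (partial axis_t (iso B) t r 0 om).
  change (partial axis_r (iso B) t r mu om) with (partial axis_r (iso B) t r 0 om).
  change (partial axis_om (iso B) t r mu om) with (partial axis_om (iso B) t r 0 om).
  field; lra.
Qed.

(** Through the flux q the product rule asks for differentiability of the product K b only, and q
    inherits that from f_1. *)
Lemma diffusion_of_flux (r : R) (K b q : R -> R) :
  0 < r -> (forall s, 0 < s -> q s = - K s * b s) -> ex_derive q r ->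
  - (1 / r ^ 2) * Derive (fun s => s ^ 2 * (K s / 3) * b s) r
  = Derive q r / 3 + 2 / (3 * r) * q r.
Proof.
  intros Hr Hq Dq.
  assert (Hext : Derive (fun s => s ^ 2 * (K s / 3) * b s) r
                 = Derive (fun s => - (s ^ 2 / 3) * q s) r).
  { apply Derive_ext_loc, filter_imp with (2 := locally_pos r Hr); intros s Hs.
    rewrite Hq by exact Hs; eq_in_R; field. }
  rewrite Hext.
  replace (Derive (fun s => - (s ^ 2 / 3) * q s) r)
    with (- (2 * r / 3) * q r - r ^ 2 / 3 * Derive q r).
  - field; lra.
  - symmetry; apply is_derive_unique; auto_derive; [auto|].
    change (Derive (fun s => q s)) with (Derive q); field.
Qed.

Lemma embed_of_nat (a : nat -> field) (m : nat) (t r mu om : R) :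
  embed a (Z.of_nat m) t r mu om = a m t r mu om.
Proof.
  unfold embed; rewrite (proj2 (Z.ltb_ge _ _)) by lia; rewrite Nat2Z.id; reflexivity.
Qed.

Lemma embed_neg (a : nat -> field) (n : Z) (t r mu om : R) :
  (n < 0)%Z -> embed a n t r mu om = 0.
Proof. intros Hn; unfold embed; rewrite (proj2 (Z.ltb_lt _ _) Hn); reflexivity. Qed.

Theorem theorem2p11
  (M : medium) (F : nat -> functional) (beta : nat -> R -> R -> R -> R)
  (f : nat -> nat -> field) (ft fs : nat -> field)
  (HM : medium_regular M)
  (Hchit : forall t r om, 0 < r -> 0 < om -> chitbar M t r om <> 0)
  (Hphi0 : forall t r om, 0 < r -> 0 < om ->
     chitbar M t r om + phi0bar M t r om <> 0)
  (Hphi1 : forall t r om, 0 < r -> 0 < om ->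
     chitbar M t r om + phi0bar M t r om - phi1bar M t r om <> 0)
  (beta_smooth : forall n, smooth (iso (beta n)))
  (f_smooth : forall i n, smooth (f i n))
  (ft_smooth : forall n, smooth (ft n))
  (fs_smooth : forall n, smooth (fs n))
  (beta_mean : forall n t r mu om, dom r mu om ->
     beta n t r om = mean (eps_sum_field 0 f n) t r mu om)
  (Henskog : enskog_postulate F beta f)
  (Hhierarchy : hierarchy M F beta f)
  (decomposition : forall n t r mu om, dom r mu om ->
     eps_sum_field 0 f n t r mu om = ft n t r mu om + fs n t r mu om)
  (weakened_CE_t : forall n t r mu om, dom r mu om ->
     mean (f 0%nat n) t r mu om = mean (ft n) t r mu om)
  (weakened_CE_s : forall n t r mu om, dom r mu om ->
     eps_sum_field 1 (fun i p => mean (f i p)) n t r mu om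
     = mean (fs n) t r mu om)
  (betas_asymptotics : forall t r om, 0 < r -> 0 < om ->
     is_O_eps 2 (jet_partial 0 (betas_functional F r om) (jet_at beta t r om)))
  (beta1_asymptotics : forall t r om, 0 < r -> 0 < om ->
     is_O_eps 2 (jet_partial 0 (mean_functional (F 1%nat) r om)
                   (jet_at beta t r om))) :
  let betat := fun n => mean (ft n) in
  let betas := fun n => mean (fs n) in
  let LHS := mean_boltzmann M (eps_sum_field 0 f) in
  (forall n t r mu om, dom r mu om ->
     LHS n t r mu om
     = emissivity M n t r mu om
       - absorption M (fun n t r mu om =>
           betat n t r mu om + betas n t r mu om) n t r mu om) /\
  laurent_O 2 (fun n t r mu om =>
    LHS n t r mu om
    - (transport M betat n t r mu om + diffusion M betat n t r mu om
       + neglected M (f 0%nat) n t r mu om)) /\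
  (forall Sigma : laurent,
     trapped_particle_equation M betat Sigma ->
     laurent_O 2 (fun n t r mu om =>
       Sigma n t r mu om
       - (diffusion M betat n t r mu om + absorption M betas n t r mu om
          + neglected M (f 0%nat) n t r mu om))).
Proof.
  intros betat betas LHS.
  assert (Hlight : 0 < light M) by apply HM.
  assert (Hf0 : forall n, (0 < n)%nat -> forall t r mu om, dom r mu om ->
    f 0%nat n t r mu om = 0).
  { intros n Hn t r mu om Hd.
    rewrite (f0_isotropic M F beta f n Hchit Hphi0 Hphi1 f_smooth Hhierarchy t r mu om Hd).
    destruct n as [|n]; [lia|]; simpl; unfold Rdiv; ring. }
  pose (B t r om := f 0%nat 0%nat t r 0 om).
  assert (HBq : quadratic_in_mu (f 0%nat 0%nat) B zero_profile zero_profile).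
  { intros t r mu om Hd; unfold B, zero_profile.
    rewrite !(f0_isotropic M F beta f 0 Hchit Hphi0 Hphi1 f_smooth Hhierarchy)
      by (unfold dom in *; tauto || lra).
    ring. }
  assert (HB : forall t r om, 0 < r -> 0 < om -> differentiable_at B t r om).
  { intros t r om Hr Ho; apply (smooth_differentiable_at (f 0%nat 0%nat) 0); auto; lra. }
  assert (Hbetat0 : forall t r mu om, dom r mu om -> betat 0%nat t r mu om = iso B t r mu om).
  { intros t r mu om Hd; unfold betat.
    rewrite <- weakened_CE_t by exact Hd.
    rewrite (mean_quartic _ t r mu om (B t r om) 0 0 0 0); [unfold iso; field|].
    intros m Hm; rewrite HBq by (unfold dom in *; repeat split; lra); unfold zero_profile; ring. }
  assert (Hbetat : forall n, (0 < n)%nat -> forall t r mu om, dom r mu om ->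
    betat n t r mu om = iso zero_profile t r mu om).
  { intros n Hn t r mu om Hd; unfold betat.
    rewrite <- weakened_CE_t by exact Hd.
    rewrite (mean_quartic _ t r mu om 0 0 0 0 0); [unfold iso, zero_profile; field|].
    intros m Hm; rewrite Hf0 by (unfold dom in *; auto; repeat split; lra); ring. }
  assert (P1 : forall n t r mu om, dom r mu om ->
     LHS n t r mu om
     = emissivity M n t r mu om
       - absorption M (fun n t r mu om =>
           betat n t r mu om + betas n t r mu om) n t r mu om).
  { intros n t r mu om Hd; unfold LHS, mean_boltzmann, emissivity, absorption, eps_mul.
    destruct (Z_lt_le_dec n 0) as [Hn|Hn].
    - rewrite (embed_neg _ n) by exact Hn.
      destruct (Z_lt_le_dec (n - -1) 0) as [Hn'|Hn'].
      + rewrite !embed_neg by exact Hn'; ring.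
      (* Order eps^-1: the left side is zero, beta^s is an empty sum, and the claim is chitbar f_0 =
         jbar. *)
      + replace (n - -1)%Z with (Z.of_nat 0) by (simpl; lia).
        rewrite !embed_of_nat; simpl Nat.eqb; cbv iota.
        rewrite Hbetat0 by exact Hd; unfold iso, B.
        rewrite (f0_isotropic M F beta f 0 Hchit Hphi0 Hphi1 f_smooth Hhierarchy)
          by (unfold dom in *; repeat split; lra).
        unfold betas; rewrite <- weakened_CE_s by exact Hd.
        unfold eps_sum_field, eps_sum; rewrite sum_n_m_zero by lia.
        change (@zero R_AbelianMonoid) with 0; simpl Nat.eqb; cbv iota.
        field; apply Hchit; apply Hd.
    (* From order eps^0 on, emissivity and beta^t are read at coefficient n + 1 > 0, where both
       vanish; only beta^s is absorbed. *)
    - replace (n - -1)%Z with (Z.of_nat (S (Z.to_nat n))) by lia.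
      replace n with (Z.of_nat (Z.to_nat n)) at 1 by lia.
      rewrite !embed_of_nat; simpl Nat.eqb; cbv iota.
      rewrite Hbetat by (auto; lia); unfold iso.
      unfold betas; rewrite <- weakened_CE_s by exact Hd.
      rewrite (mean_Dop_eps_sum M F beta f) by (auto; apply Hd).
      unfold zero_profile; ring. }
  assert (P2 : laurent_O 2 (fun n t r mu om =>
    LHS n t r mu om
    - (transport M betat n t r mu om + diffusion M betat n t r mu om
       + neglected M (f 0%nat) n t r mu om))).
  { intros n t r mu om Hn Hd.
    assert (Hd' := Hd); destruct Hd' as (Hr & Hm & Ho).
    unfold LHS, mean_boltzmann, transport, diffusion, neglected, eps_mul.
    assert (C : (n < 0 \/ n = Z.of_nat 0 \/ n = Z.of_nat 1)%Z) by lia.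
    destruct C as [C | [-> | ->]].
    - rewrite !embed_neg by lia; ring.
    (* Order eps^0: the factor eps moves [diffusion] and [neglected] to index -1, where they
       vanish. *)
    - rewrite !embed_of_nat, !embed_neg by (simpl; lia).
      rewrite (mean_Dop_isotropic M (eps_sum_field 0 f 0) B); auto.
      + unfold Ddt.
        change d_t with (partial axis_t); change d_r with (partial axis_r);
        change d_om with (partial axis_om).
        rewrite !(fun a Ha => partial_ext_dom a (betat 0%nat) (iso B) t r mu om Ha Hbetat0 Hd)
          by discriminate.
        ring.
      + intros t' r' mu' om' Hd'; unfold eps_sum_field, eps_sum.
        rewrite sum_n_n; apply HBq; exact Hd'.
    - replace (Z.of_nat 1 - 1)%Z with (Z.of_nat 0) by reflexivity.
      rewrite !embed_of_nat.
      destruct (Jbar_inv_isotropic M (f 0%nat 0%nat) B Hphi0 Hphi1 HBq HB)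
        as (e & c & Hfull & Heven).
      assert (Hf1 : forall t r mu om, dom r mu om ->
        f 1%nat 0%nat t r mu om = Jbar_inv M (Dop M (f 0%nat 0%nat)) t r mu om).
      { intros t' r' mu' om' (Hr' & Hm' & Ho').
        apply Jbar_inv_correct; auto; [repeat split; lra|].
        intros m Hm1; rewrite <- (proj2 Hhierarchy 0%nat 0%nat t' r' m om')
          by (repeat split; lra).
        assert (Hd1 : dom r' m om') by (repeat split; lra).
        (* Resummation at n = 0 identifies D(f)^(0) with D(f_0), trading the time derivative through
           the jet for the true one. *)
        assert (H := Dop_eps_sum M F beta f f_smooth beta_mean Henskog 0 t' r' m om' Hd1).
        rewrite sum_O in H; change (0 - 0)%nat with 0%nat in H; rewrite <- H.
        unfold Dop, Dplus, Defs.Dminus, Ddt.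
        change d_t with (partial axis_t); change d_r with (partial axis_r);
        change d_mu with (partial axis_mu); change d_om with (partial axis_om).
        rewrite !partial_eps_sum by auto; rewrite !sum_O; reflexivity. }
      set (q := fun t r om => - lambar M t r om * d_r (iso B) t r 0 om) in *.
      assert (Hq1 : quadratic_in_mu (f 1%nat 0%nat) e q c).
      { intros t' r' mu' om' Hd'; rewrite Hf1 by exact Hd'; apply Hfull; exact Hd'. }
      assert (Hq : quadratic_in_mu (eps_sum_field 0 f 1) e q c).
      { intros t' r' mu' om' Hd'; rewrite <- Hq1 by exact Hd'.
        unfold eps_sum_field, eps_sum; rewrite sum_n_Sm, sum_n_n by lia.
        rewrite Hf0 by (auto; lia); exact (Rplus_0_l _). }
      destruct (differentiable_at_coefficients _ e q c t r om (f_smooth 1%nat 0%nat) Hq1 Hr Ho)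
        as (De & Dq & Dc).
      rewrite (mean_Dop_quadratic M (eps_sum_field 0 f 1) e q c) by assumption.
      rewrite (mean_Dplus_quadratic M (eps_sum_field 0 f 1) e q c) by assumption.
      (* This unfolded [neglected] has the same even coefficients [e] and [c] as f_1. The D^+ mean
         does not see the odd one, so both D^+ means cancel and the flux part remains. *)
      change (mean _ t r mu om)
        with (mean (Dplus M (Jbar_inv M (Dplus M (f 0%nat 0%nat)))) t r mu om).
      rewrite (mean_Dplus_quadratic M (Jbar_inv M (Dplus M (f 0%nat 0%nat))) e zero_profile c)
        by auto using differentiable_at_zero.
      unfold Ddt.
      change d_t with (partial axis_t); change d_om with (partial axis_om).
      assert (Ht : forall a, a <> axis_mu -> partial a (betat 1%nat) t r mu om = 0).
      { intros a Ha; rewrite (partial_ext_dom a _ (iso zero_profile)); auto using partial_zero. }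
      rewrite (Ht axis_t), (Ht axis_om) by discriminate.
      change (d_r (betat 1%nat)) with (partial axis_r (betat 1%nat)).
      rewrite (Ht axis_r) by discriminate.
      assert (Hflux : - (1 / r ^ 2) * d_r (fun t r mu om =>
          r ^ 2 * (lambar M t r om / 3) * d_r (betat 0%nat) t r mu om) t r mu om
        = d_r (iso q) t r 0 om / 3 + 2 / (3 * r) * q t r om).
      { apply (diffusion_of_flux r (fun s => lambar M t s om)
          (fun s => d_r (betat 0%nat) t s mu om) (fun s => q t s om)); auto.
        - intros s Hs; unfold q; f_equal.
          symmetry; refine (partial_ext_dom axis_r (betat 0%nat) (iso B) t s mu om _ Hbetat0 _);
            [discriminate | repeat split; lra].
        - exact (Dq axis_r). }
      rewrite Hflux; unfold Rdiv; ring. }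
  split; [exact P1 | split; [exact P2 |]].
  intros Sigma HS n t r mu om Hn Hd.
  (* Replacing [LHS] in [P2] by the right side of Boltzmann's equation leaves a linear relation from
     which the equation for Sigma eliminates [transport]. *)
  assert (E := P2 n t r mu om Hn Hd); cbv beta in E; rewrite P1 in E by exact Hd.
  specialize (HS n t r mu om Hd).
  assert (Ha : absorption M (fun n t r mu om => betat n t r mu om + betas n t r mu om)
                 n t r mu om
               = absorption M betat n t r mu om + absorption M betas n t r mu om).
  { unfold absorption, eps_mul, embed; destruct (Z.ltb _ _); ring. }
  lra.
Qed.
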